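(* Let $C$ be a real number. Problem (DREG) is a strong dual of problem (CREG): the optimal value (supremum) of (CREG) equals the optimal value (infimum) of (DREG). Moreover, let $(\bm P^*,\alpha^*_{ij},\beta^*_{ij})$ be an optimal solution of (CREG) and $(\bm Q^*,r^*_{ij},s^*_{ij},u^*_{ij},v^*_{ij})$ an optimal solution of (DREG), completed to vectors $\bm\lambda^*_{ij}=(r^*_{ij},s^*_{ij},t^*_{ij})$ and $\bm\nu^*_{ij}=(u^*_{ij},v^*_{ij},w^*_{ij})$ for all $i\neq j$ by $t^*_{ij}=-1,\ w^*_{ij}=0,\ v^*_{ij}=0$ if $i\sim j$ and $t^*_{ij}=0,\ w^*_{ij}=-1,\ s^*_{ij}=0$ if $i\not\sim j$. Then $\bm P^*\bm Q^*=\bm 0$, and for all $i\ne j$ $$0=\bm\lambda_{ij}^*\cdot(P^*_{ij},1,\alpha^*_{ij})=r^*_{ij}P^*_{ij}+s^*_{ij}+t^*_{ij}\alpha^*_{ij},$$ $$0=\bm\nu_{ij}^*\cdot(1-P^*_{ij},1,\beta^*_{ij})=u^*_{ij}(1-P^*_{ij})+v^*_{ij}+w^*_{ij}\beta^*_{ij}.$$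
   Context: $G=(V,E)$ is a simple undirected graph with $V=\{1,\dots,n\}$. For distinct $i,j$ write $i\sim j$ if $\{i,j\}\in E$ and $i\not\sim j$ otherwise; sums over $i\sim j$, $i\not\sim j$, $i\ne j$ are over ordered pairs of distinct indices. $\bm M\succeq0$ means $\bm M$ is real symmetric positive semidefinite. Optimal values are in $[-\infty,\infty]$, with infimum over the empty set $+\infty$. $K_{\exp}=\{(x,y,z)\in\mathbb R^3: x\ge y\exp(z/y),\ y>0\}\cup\{(x,0,z):x\ge0,\ z\le0\}$. (CREG): maximize $\sum_{i\sim j}\alpha_{ij}+\sum_{i\not\sim j}\beta_{ij}-C\operatorname{tr}\bm P$ over real symmetric $n\times n$ matrices $\bm P$ and real numbers $\alpha_{ij},\beta_{ij}$ ($i\ne j$) subject to $\bm P\succeq 0$, and $(P_{ij},1,\alpha_{ij})\in K_{\exp}$, $(1-P_{ij},1,\beta_{ij})\in K_{\exp}$ for all $i\ne j$. (DREG): minimize $\sum_{i\sim j}s_{ij}+\sum_{i\not\sim j}v_{ij}+\sum_{i\ne j}u_{ij}$ over a real symmetric $n\times n$ matrix $\bm Q$ and real numbers $r_{ij},u_{ij}$ ($i\ne j$), $s_{ij}$ ($i\sim j$), $v_{ij}$ ($i\not\sim j$), subject to $s_{ij}\ge -1-\log r_{ij}$ for $i\sim j$; $v_{ij}\ge -1-\log u_{ij}$ for $i\not\sim j$; $u_{ij}-r_{ij}=Q_{ij}$ and $u_{ij},r_{ij}\ge 0$ for $i\ne j$; $Q_{ii}=C$ for all $i$; $\bm Q\succeq0$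 (with $-\log 0=+\infty$). *)

(* Defs.v *)
From HB Require Import structures.
From mathcomp Require Import all_boot all_order all_algebra.
From mathcomp Require Import all_classical all_reals all_analysis.

Set Implicit Arguments.
Unset Strict Implicit.
Unset Printing Implicit Defensive.

Import Order.TTheory GRing.Theory Num.Theory.

Local Open Scope classical_set_scope.
Local Open Scope ring_scope.

Definition psd (R : realType) (n : nat) (M : 'M[R]_n) : Prop :=
  M^T = M /\ forall x : 'cV[R]_n, 0 <= (x^T *m M *m x) 0 0.

Definition Kexp (R : realType) : set (R * R * R) :=
  [set p | let: (x, y, z) := p in x >= y * expR (z / y) /\ y > 0] `|`
  [set p | let: (x, y, z) := p in [/\ y = 0, x >= 0 & z <= 0]].

Definition dot3 (R : realType) (a b : R * R * R) : R :=
  let: (a1, a2, a3) := a in let: (b1, b2, b3) := b in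
  a1 * b1 + a2 * b2 + a3 * b3.

(* A graph on n vertices is a symmetric irreflexive relation e on 'I_n.
   Families of real numbers indexed by some of the ordered pairs (i, j) are
   total functions; their values at the other pairs enter neither the
   constraints nor the objective. *)
Definition nonadj (n : nat) (e : rel 'I_n) : rel 'I_n :=
  [rel i j | (i != j) && ~~ e i j].

Record creg_point (R : realType) (n : nat) := CregPoint {
  cP : 'M[R]_n;
  calpha : 'I_n -> 'I_n -> R;
  cbeta : 'I_n -> 'I_n -> R }.

Definition creg_feasible (R : realType) (n : nat) (x : creg_point R n) : Prop :=
  psd (cP x) /\
  forall i j : 'I_n, i != j ->
    Kexp (cP x i j, 1, calpha x i j) /\ Kexp (1 - cP x i j, 1, cbeta x i j).

Definition creg_obj (R : realType) (n : nat) (e : rel 'I_n) (C : R)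
    (x : creg_point R n) : R :=
  \sum_i \sum_(j | e i j) calpha x i j
  + \sum_i \sum_(j | nonadj e i j) cbeta x i j
  - C * \tr (cP x).

Definition creg_value (R : realType) (n : nat) (e : rel 'I_n) (C : R) : \bar R :=
  ereal_sup [set (creg_obj e C x)%:E | x in @creg_feasible R n].

Definition creg_optimal (R : realType) (n : nat) (e : rel 'I_n) (C : R)
    (x : creg_point R n) : Prop :=
  creg_feasible x /\
  forall y, creg_feasible y -> creg_obj e C y <= creg_obj e C x.

Record dreg_point (R : realType) (n : nat) := DregPoint {
  dQ : 'M[R]_n;
  dr : 'I_n -> 'I_n -> R;
  ds : 'I_n -> 'I_n -> R;
  du : 'I_n -> 'I_n -> R;
  dv : 'I_n -> 'I_n -> R }.

(* lne is the extended-real logarithm, with lne 0 = -oo (whereas ln 0 = 0). *)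
Definition dreg_feasible (R : realType) (n : nat) (e : rel 'I_n) (C : R)
    (y : dreg_point R n) : Prop :=
  [/\ forall i j, e i j -> ((ds y i j)%:E >= (-1)%:E - lne (dr y i j)%:E)%E,
      forall i j, nonadj e i j ->
        ((dv y i j)%:E >= (-1)%:E - lne (du y i j)%:E)%E,
      forall i j : 'I_n, i != j ->
        [/\ du y i j - dr y i j = dQ y i j, du y i j >= 0 & dr y i j >= 0],
      forall i, dQ y i i = C
    & psd (dQ y)].

Definition dreg_obj (R : realType) (n : nat) (e : rel 'I_n)
    (y : dreg_point R n) : R :=
  \sum_i \sum_(j | e i j) ds y i j
  + \sum_i \sum_(j | nonadj e i j) dv y i j
  + \sum_i \sum_(j | i != j) du y i j.

Definition dreg_value (R : realType) (n : nat) (e : rel 'I_n) (C : R) : \bar R :=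
  ereal_inf [set (dreg_obj e y)%:E | y in @dreg_feasible R n e C].

Definition dreg_optimal (R : realType) (n : nat) (e : rel 'I_n) (C : R)
    (y : dreg_point R n) : Prop :=
  dreg_feasible e C y /\
  forall z, dreg_feasible e C z -> dreg_obj e y <= dreg_obj e z.

(* Completion of a point of (DREG) to vectors lambda_ij = (r_ij, s_ij, t_ij)
   and nu_ij = (u_ij, v_ij, w_ij) for all i != j. *)
Section completion.
Context (R : realType) (n : nat) (e : rel 'I_n) (y : dreg_point R n).
Implicit Types i j : 'I_n.

Definition s_full i j : R := if e i j then ds y i j else 0.
Definition t_full i j : R := if e i j then -1 else 0.
Definition v_full i j : R := if e i j then 0 else dv y i j.
Definition w_full i j : R := if e i j then 0 else -1.

Definition lambda_vec i j : R * R * R := (dr y i j, s_full i j, t_full i j).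
Definition nu_vec i j : R * R * R := (du y i j, v_full i j, w_full i j).
End completion.

(* Main.v *)
(* Since u - r = Q off the diagonal and Q_ii = C, the duality gap of a feasible
   pair is tr (P Q) plus the sum over i != j of the products lambda . (P, 1, alpha)
   and nu . (1 - P, 1, beta). The trace is nonnegative, being a sum of values
   v^T Q v once P is written as a sum of v v^T, and the products are nonnegative
   by ln z <= z - 1. This is weak duality, and each term vanishes at a pair of
   zero gap.

   For C > 0 the supremum of (CREG) may be approached only as P_ij -> 1 on an
   edge (or P_ij -> 0 on a non-edge). Adding eps times the missing logarithms
   makes the maximum attained at some P strictly inside the box. Stationarity of
   the modified objective along x x^T and along - P says that
   Q_ij = u_ij - r_ij, Q_ii = C, is positive semidefinite with tr (P Q) <= 0, where
   (r, u) = (1 / P, eps / (1 - P)) on edges and (eps / P, 1 / (1 - P)) on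
   non-edges; the gap of this pair is eps times the number of pairs i != j. For
   C = 0 the diagonal of P is free, so that Q = 0, r = u = 1 is dual optimal. For
   C < 0 (and n > 0) both values are +oo. *)

Require Import Defs.
From HB Require Import structures.
From mathcomp Require Import all_boot all_order all_algebra.
From mathcomp Require Import all_classical all_reals all_analysis.
From mathcomp Require Import ring lra.

Set Implicit Arguments.
Unset Strict Implicit.
Unset Printing Implicit Defensive.

Import Order.TTheory GRing.Theory Num.Theory.
Import numFieldNormedType.Exports.

Local Open Scope ring_scope.

(** * Positive semidefinite matrices *)

Section PositiveSemidefinite.
Context {R : realType} {n : nat}.
Implicit Types (M P Q : 'M[R]_n) (x y v : 'cV[R]_n).

Local Notation ev i := (delta_mx i 0 : 'cV[R]_n).

Lemma bilinE M x y :
  (x^T *m M *m y) 0 0 = \sum_i \sum_j M i j * (x i 0 * y j 0).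
Proof.
rewrite mxE exchange_big /=; apply: eq_bigr => j _.
rewrite mxE mulr_suml; apply: eq_bigr => i _.
by rewrite !mxE mulrCA mulrA.
Qed.

Lemma bilin_delta M i j :
  ((ev i)^T *m M *m ev j) 0 0 = M i j.
Proof. by rewrite trmx_delta -rowE -colE !mxE. Qed.

Lemma bilinC M x y : M^T = M -> (x^T *m M *m y) 0 0 = (y^T *m M *m x) 0 0.
Proof.
move=> sM; rewrite -[RHS]trace_mx11 -mxtrace_tr trace_mx11.
by rewrite !trmx_mul sM trmxK mulmxA.
Qed.

Lemma psd_cauchy_schwarz M x y : psd M ->
  (x^T *m M *m y) 0 0 ^+ 2 <= (x^T *m M *m x) 0 0 * (y^T *m M *m y) 0 0.
Proof.
case=> sM pM.
set a := (x^T *m M *m x) 0 0; set b := (x^T *m M *m y) 0 0.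
set c := (y^T *m M *m y) 0 0.
have q t : 0 <= a - t * b *+ 2 + t ^+ 2 * c.
  suff -> : a - t * b *+ 2 + t ^+ 2 * c
      = ((x - t *: y)^T *m M *m (x - t *: y)) 0 0 by exact: pM.
  have yx : (y^T *m M *m x) 0 0 = b by rewrite bilinC.
  rewrite [(x - _)^T]linearB /= [(t *: y)^T]linearZ /= !mulmxBl !mulmxBr.
  rewrite -!scalemxAl -!scalemxAr.
  by move: yx; rewrite /a /b /c !mxE => ->; ring.
have := pM y; rewrite -/c le_eqVlt => /orP[/eqP c0|c_gt0].
  rewrite -c0 mulr0; have [->|b0] := eqVneq b 0; first by rewrite expr0n.
  (* With [c = 0] the form is affine in [t]; unless [b = 0], this [t] gives it the value [-1]. *)
  have := q ((a + 1) / (b *+ 2)); rewrite -c0.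
  suff -> : a - (a + 1) / (b *+ 2) * b *+ 2 + ((a + 1) / (b *+ 2)) ^+ 2 * 0 = -1.
    by rewrite ler0N1.
  by field.
(* The minimizer of the quadratic in [t]; its minimum is [(a c - b^2) / c]. *)
have := q (b / c).
have -> : a - b / c * b *+ 2 + (b / c) ^+ 2 * c = (a * c - b ^+ 2) / c.
  by field; rewrite gt_eqF.
by rewrite pmulr_lge0 ?invr_gt0 // subr_ge0.
Qed.

Lemma psd_diag_ge0 M i : psd M -> 0 <= M i i.
Proof. by case=> _ /(_ (ev i)); rewrite bilin_delta. Qed.

Lemma psd_mx_eq0 M i j : psd M -> M i i = 0 -> M i j = 0.
Proof.
move=> pM Mii0.
have := psd_cauchy_schwarz (ev i) (ev j) pM.
rewrite !bilin_delta Mii0 mul0r => le0; apply/eqP.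
by rewrite -sqrf_eq0 eq_le le0 sqr_ge0.
Qed.

(** Cauchy-Schwarz of [x] against each unit vector bounds the coordinates of [M *m x] by zero. *)
Lemma psd_mulmx_eq0 M x : psd M -> (x^T *m M *m x) 0 0 = 0 -> M *m x = 0.
Proof.
move=> pM q0; apply/matrixP => i k; rewrite ord1 [RHS]mxE.
have := psd_cauchy_schwarz (ev i) x pM.
rewrite q0 mulr0 trmx_delta -rowE -row_mul mxE => le0; apply/eqP.
by rewrite -sqrf_eq0 eq_le le0 sqr_ge0.
Qed.

(* A nonzero diagonal entry M i i can be peeled off by subtracting
   col i M (col i M)^T / M i i: this clears row i, and Cauchy-Schwarz says that
   the remainder is still positive semidefinite. *)
Lemma psd_rank1_ind (T : 'M[R]_n -> Prop) :
    T 0 -> (forall M v, T M -> T (M + v *m v^T)) ->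
  forall M, psd M -> T M.
Proof.
(* Induction on the number of nonzero diagonal entries. *)
move=> T0 TD M; move: {2}_.+1 (ltnSn #|[set i | M i i != 0]|) => k.
elim: k M => // k IHk M; rewrite ltnS => leMk pM.
have [Mdiag0|/forallPn[i Mii0]] := boolP [forall i, M i i == 0].
  suff -> : M = 0 by [].
  by apply/matrixP=> i j; rewrite mxE psd_mx_eq0 //; apply/eqP/(forallP Mdiag0).
have c_gt0 : 0 < M i i by rewrite lt_neqAle eq_sym Mii0 psd_diag_ge0.
pose v := (Num.sqrt (M i i))^-1 *: col i M.
have vE j l : (v *m v^T) j l = M j i * M l i / M i i.
  rewrite !mxE big_ord1 !mxE -[in RHS](@sqr_sqrtr _ (M i i)) ?ltW //.
  by field; rewrite gt_eqF // sqrtr_gt0.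
have symM j l : M j l = M l j by rewrite -[in LHS](proj1 pM) mxE.
pose N := M - v *m v^T.
have NE j : N j j = M j j - M j i * M j i / M i i by rewrite mxE [in X in _ + X]mxE vE.
have -> : M = N + v *m v^T by rewrite subrK.
apply: TD; apply: IHk.
  (* A zero diagonal entry has a zero row, so peeling keeps it zero, while entry [i] becomes zero:
     the count drops. *)
  apply: leq_trans leMk; apply: proper_card; apply/fintype.properP; split.
    apply/fintype.subsetP=> j; rewrite !inE; apply: contraNneq => Mjj0.
    by rewrite NE Mjj0 psd_mx_eq0 // !mul0r subr0.
  exists i; rewrite !inE //.
  by rewrite NE mulfK ?subrr ?eqxx.
split=> [|x]; first by rewrite linearB /= trmx_mul trmxK (proj1 pM).
have -> : (x^T *m N *m x) 0 0
    = (x^T *m M *m x) 0 0 - (x^T *m M *m ev i) 0 0 ^+ 2 / M i i.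
  rewrite mulmxBr mulmxBl [LHS]mxE; congr (_ + _); rewrite mxE; congr (- _).
  have xv : (x^T *m v) 0 0
      = (Num.sqrt (M i i))^-1 * (x^T *m M *m ev i) 0 0.
    by rewrite -mulmxA -colE /v -scalemxAr mxE.
  rewrite !mulmxA -[_ *m v *m _ *m x]mulmxA mxE big_ord1.
  have -> : (v^T *m x) 0 0 = (x^T *m v) 0 0.
    by rewrite -[RHS]trace_mx11 -mxtrace_tr trace_mx11 trmx_mul trmxK.
  rewrite xv -[in RHS](@sqr_sqrtr _ (M i i)) ?ltW //.
  by field; rewrite gt_eqF // sqrtr_gt0.
rewrite subr_ge0 ler_pdivrMr //.
by have := psd_cauchy_schwarz x (ev i) pM; rewrite bilin_delta.
Qed.

Lemma psdD M N : psd M -> psd N -> psd (M + N).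
Proof.
move=> [sM pM] [sN pN]; split=> [|x]; first by rewrite linearD /= sM sN.
by rewrite mulmxDr mulmxDl mxE addr_ge0.
Qed.

Lemma psdZ a M : 0 <= a -> psd M -> psd (a *: M).
Proof.
move=> a0 [sM pM]; split=> [|x]; first by rewrite linearZ /= sM.
by rewrite -scalemxAr -scalemxAl mxE mulr_ge0.
Qed.

Lemma psd_rank1 v : psd (v *m v^T).
Proof.
split=> [|x]; first by rewrite trmx_mul trmxK.
rewrite mulmxA -mulmxA mxE big_ord1.
have -> : (v^T *m x) 0 0 = (x^T *m v) 0 0.
  by rewrite -[RHS]trace_mx11 -mxtrace_tr trace_mx11 trmx_mul trmxK.
by rewrite -expr2 sqr_ge0.
Qed.

(** Each rank-one summand of [P] contributes [v^T Q v >= 0]. If the total is zero, every such value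
    is zero, hence [Q v = 0] and [v v^T Q = 0]. *)
Lemma psd_tr_mul P Q : psd P -> psd Q ->
  0 <= \tr (P *m Q) /\ (\tr (P *m Q) = 0 -> P *m Q = 0).
Proof.
move=> pP pQ; move: P pP; apply: psd_rank1_ind => [|P v [tr0 IHP]].
  by rewrite mul0mx mxtrace0.
have trv : \tr (v *m v^T *m Q) = (v^T *m Q *m v) 0 0.
  by rewrite -mulmxA mxtrace_mulC trace_mx11.
have vQv := pQ.2 v; rewrite mulmxDl linearD /= trv.
split=> [|/eqP]; first exact: addr_ge0.
rewrite paddr_eq0 // => /andP[/eqP /IHP -> /eqP vQv0].
have Qv0 := psd_mulmx_eq0 pQ vQv0.
by rewrite add0r -mulmxA -[v^T *m Q]trmxK trmx_mul trmxK pQ.1 Qv0 trmx0 mulmx0.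
Qed.

Lemma mxtrace_mul_sym P Q : Q^T = Q ->
  \tr (P *m Q) = \sum_i \sum_j P i j * Q i j.
Proof.
move=> sQ; apply: eq_bigr => i _; rewrite mxE; apply: eq_bigr => j _.
by rewrite -[in LHS]sQ mxE.
Qed.

(** Supplies feasible points of (CREG) with prescribed off-diagonal entries, at the price of a large
    diagonal. *)
Lemma diag_dominant_psd M : M^T = M ->
    (forall i j, i != j -> 0 <= M i j <= 1) -> (forall i, n%:R <= M i i) ->
  psd M.
Proof.
move=> sM offdiag diag; split=> // x; rewrite bilinE.
(* With [S] the sum of the [x_i^2], these bounds add up to [n S - n S = 0]. *)
have lb i j : (if j == i then n%:R * x i 0 ^+ 2 else 0)
    - (x i 0 ^+ 2 + x j 0 ^+ 2) / 2 <= M i j * (x i 0 * x j 0).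
  have [<-|/offdiag /andP[M0 M1]] := eqVneq i j.
    have := diag i; have := sqr_ge0 (x i 0); nra.
  have := sqr_ge0 (x i 0 + x j 0).
  have := sqr_ge0 (x i 0); have := sqr_ge0 (x j 0); nra.
apply: le_trans (ler_sum _ (fun i _ => ler_sum _ (fun j _ => lb i j))).
under eq_bigr do rewrite big_split /= -big_mkcond /= big_pred1_eq sumrN -mulr_suml
   big_split /= sumr_const card_ord.
rewrite big_split /= sumrN -mulr_suml big_split /= sumr_const card_ord sumrMnl.
rewrite -mulr_sumr; set S := \sum_(i < n) _.
by rewrite -[S *+ n]mulr_natl; lra.
Qed.

End PositiveSemidefinite.

(** * Weak duality and complementary slackness *)

Lemma Kexp_at1 (R : realType) (p a : R) : Kexp (p, 1, a) <-> expR a <= p.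
Proof.
rewrite /Kexp /=; split=> [[[]|[/eqP]]|ap]; rewrite ?divr1 ?mul1r //.
  by rewrite oner_eq0.
by left.
Qed.

(** At [r = 0] the constraint would read [s >= +oo], so it forces [r > 0], where [lne] is the real
    [ln]. *)
Lemma lne_constraint (R : realType) (r s : R) : 0 <= r ->
  ((s%:E >= (-1)%:E - lne r%:E)%E) <-> 0 < r /\ -1 - ln r <= s.
Proof.
rewrite le_eqVlt => /predU1P[<-|r0].
  by rewrite le0_lneNy //= ltxx leye_eq; split=> [|[]].
by rewrite lne_EFin // -EFinN -EFinD lee_fin; split=> [|[]].
Qed.

(** Add [a <= ln p] to the inequality [ln z <= z - 1] at [z = r p]. *)
Lemma ln_fenchel (R : realType) (r p a s : R) :
  0 < r -> expR a <= p -> -1 - ln r <= s -> 0 <= r * p + s - a.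
Proof.
move=> r0 ap rs; have p0 : 0 < p by apply: lt_le_trans ap; exact: expR_gt0.
have alnp : a <= ln p by rewrite -ler_expR lnK.
have : ln (1 + (r * p - 1)) <= r * p - 1.
  by apply: le_ln1Dx; rewrite ltrBrDl subrr mulr_gt0.
by rewrite addrC subrK lnM ?posrE //; lra.
Qed.

Section WeakDuality.
Context {R : realType} {n : nat} (e : rel 'I_n) (C : R).
Hypothesis e_irr : irreflexive e.

Lemma sum_adj_nonadj (f g : 'I_n -> 'I_n -> R) :
  \sum_i \sum_(j | e i j) f i j + \sum_i \sum_(j | nonadj e i j) g i j
    = \sum_i \sum_(j | i != j) (if e i j then f i j else g i j).
Proof.
rewrite -big_split; apply: eq_bigr => i _ /=.
rewrite [RHS](bigID (e i)) /=; congr (_ + _); apply: eq_big => j //.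
- by case: eqVneq => // <-; rewrite e_irr.
- by move=> ->.
- by case/andP=> _ /negbTE->.
Qed.

Definition slack (x : creg_point R n) (y : dreg_point R n) i j : R :=
  dot3 (lambda_vec e y i j) (cP x i j, 1, calpha x i j)
  + dot3 (nu_vec e y i j) (1 - cP x i j, 1, cbeta x i j).

Lemma duality_gap x y : dreg_feasible e C y ->
  dreg_obj e y - creg_obj e C x
    = \tr (cP x *m dQ y) + \sum_i \sum_(j | i != j) slack x y i j.
Proof.
case=> _ _ urQ Qdiag [sQ _].
(* The constraint [Q_ii = C] makes the diagonal part of the trace equal to the penalty [C * \tr P]
   of (CREG). *)
have -> : \tr (cP x *m dQ y)
    = \sum_i \sum_(j | i != j) cP x i j * (du y i j - dr y i j)
      + C * \tr (cP x).
  rewrite mxtrace_mul_sym // [C * _]mulr_sumr -big_split; apply: eq_bigr => i _ /=.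
  rewrite (bigD1 i) //= Qdiag addrC mulrC; congr (_ + _).
  by apply: eq_big => j; rewrite eq_sym // => /urQ[->].
rewrite /dreg_obj /creg_obj !sum_adj_nonadj opprB addrCA.
rewrite [in RHS](addrC _ (C * _)) -[in RHS]addrA; congr (_ + _).
rewrite -sumrN -!big_split; apply: eq_bigr => i _ /=.
rewrite -sumrN -!big_split; apply: eq_bigr => j ij /=.
rewrite /slack /= /s_full /v_full /t_full /w_full.
by case: (e i j); ring.
Qed.

(** On an edge this is [ln_fenchel]; on a non-edge the completion leaves only [r * P], where
    [P >= expR alpha]. *)
Lemma dot3_lambda_ge0 x y i j : creg_feasible x -> dreg_feasible e C y ->
  i != j -> 0 <= dot3 (lambda_vec e y i j) (cP x i j, 1, calpha x i j).
Proof.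
move=> [_ xK] [ys _ yur _ _] ij; have [/Kexp_at1 Pa _] := xK i j ij.
have [_ _ r0] := yur i j ij; rewrite /= /s_full /t_full; case: ifPn => eij.
  rewrite mulr1 mulN1r.
  by have [rp ?] := (lne_constraint _ r0).1 (ys i j eij); exact: ln_fenchel.
rewrite mul0r mul0r !addr0 mulr_ge0 //.
by apply: le_trans Pa; exact: expR_ge0.
Qed.

Lemma dot3_nu_ge0 x y i j : creg_feasible x -> dreg_feasible e C y ->
  i != j -> 0 <= dot3 (nu_vec e y i j) (1 - cP x i j, 1, cbeta x i j).
Proof.
move=> [_ xK] [_ yv yur _ _] ij; have [_ /Kexp_at1 Pb] := xK i j ij.
have [_ u0 _] := yur i j ij; rewrite /= /v_full /w_full; case: ifPn => eij.
  rewrite mul0r mul0r !addr0 mulr_ge0 //.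
  by apply: le_trans Pb; exact: expR_ge0.
have neij : nonadj e i j by apply/andP.
rewrite mulr1 mulN1r.
by have [up ?] := (lne_constraint _ u0).1 (yv i j neij); exact: ln_fenchel.
Qed.

Lemma slack_ge0 x y i j : creg_feasible x -> dreg_feasible e C y ->
  i != j -> 0 <= slack x y i j.
Proof.
by move=> fx fy ij; rewrite addr_ge0 ?dot3_lambda_ge0 ?dot3_nu_ge0.
Qed.

Lemma weak_duality x y : creg_feasible x -> dreg_feasible e C y ->
  creg_obj e C x <= dreg_obj e y.
Proof.
move=> fx fy; rewrite -subr_ge0 duality_gap // addr_ge0 //.
  by have [_ _ _ _ pQ] := fy; have [] := psd_tr_mul fx.1 pQ.
by apply: sumr_ge0 => i _; apply: sumr_ge0 => j; exact: slack_ge0.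
Qed.

Lemma complementary_slackness x y : creg_feasible x -> dreg_feasible e C y ->
    creg_obj e C x = dreg_obj e y ->
  cP x *m dQ y = 0 /\ forall i j, i != j ->
    dot3 (lambda_vec e y i j) (cP x i j, 1, calpha x i j) = 0 /\
    dot3 (nu_vec e y i j) (1 - cP x i j, 1, cbeta x i j) = 0.
Proof.
move=> fx fy xy; have [_ _ _ _ pQ] := fy.
have [tr0 PQ0] := psd_tr_mul fx.1 pQ.
have srow0 i : 0 <= \sum_(j | i != j) slack x y i j.
  by apply: sumr_ge0 => j; exact: slack_ge0.
have /esym/eqP := duality_gap x fy.
rewrite xy subrr paddr_eq0 //; last by apply: sumr_ge0 => i _.
case/andP=> /eqP /PQ0 -> /eqP sl0.
split=> // i j ij.
have row0 : \sum_(k | i != k) slack x y i k = 0.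
  by exact: (psumr_eq0P (fun k _ => srow0 k) sl0).
have /eqP : slack x y i j = 0.
  by apply: (psumr_eq0P _ row0 ij) => k; exact: slack_ge0.
rewrite paddr_eq0 ?dot3_lambda_ge0 ?dot3_nu_ge0 //.
by case/andP=> /eqP -> /eqP ->.
Qed.

End WeakDuality.

(** * The barrier problem *)

Lemma continuous_sum (R : realType) (T : topologicalType) (I : Type) (r : seq I)
    (P : pred I) (F : I -> T -> R) (x : T) :
    (forall i, P i -> {for x, continuous (F i)}) ->
  {for x, continuous (fun v => \sum_(i <- r | P i) F i v)}.
Proof. by move=> cF; apply: cvg_big => //; exact: add_continuous. Qed.

Lemma closed_fun_ge0 (R : realType) (T : topologicalType) (f : T -> R) : continuous f ->
  closed [set v | 0 <= f v]%classic.
Proof. by move=> cf; apply: preimage_closed (@closed_ge _ 0) => v _; exact: cf. Qed.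

Section MatrixTopology.
Context {R : realType} {n : nat}.

Definition offdiag_in (d : R) (P : 'M[R]_n) := forall i j, i != j -> d <= P i j <= 1 - d.

Lemma vec_mx_coord_continuous i j : continuous (fun v => (vec_mx v : 'M[R]_n) i j).
Proof.
have -> : (fun v => (vec_mx v : 'M[R]_n) i j) = (fun v => v 0 (mxvec_index i j)).
  by apply/funext => v; rewrite mxE.
exact: coord_continuous.
Qed.

(** An intersection of closed half-spaces: symmetry is [M i j - M j i >= 0] for all ordered pairs,
    and each [x] gives an inequality linear in [M]. Matrices are read as row vectors, where
    [rV_compact] gives compact boxes. *)
Lemma closed_psd : closed [set v | psd (vec_mx v : 'M[R]_n)]%classic.
Proof.
have -> : [set v | psd (vec_mx v : 'M[R]_n)]%classic =
    (\bigcap_(i in setT) \bigcap_(j in setT)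
       [set v | 0 <= (vec_mx v : 'M[R]_n) i j - (vec_mx v : 'M[R]_n) j i] `&`
    \bigcap_(x in [set: 'cV[R]_n])
       [set v | 0 <= \sum_i \sum_j (vec_mx v : 'M[R]_n) i j * (x i 0 * x j 0)])%classic.
  apply/seteqP; split=> v /=.
    move=> [sv pv]; split=> [i _ j _|x _] /=; last by rewrite -bilinE.
    by rewrite -[in X in X - _]sv [_^T _ _]mxE subrr.
  move=> [sv pv]; split=> [|x]; last by rewrite bilinE; exact: pv.
  apply/matrixP => i j; rewrite [LHS]mxE; apply/eqP.
  by rewrite eq_le -subr_ge0 (sv i I j I) -subr_ge0 (sv j I i I).
apply: closedI; apply: closed_bigI => i _.
  apply: closed_bigI => j _; apply: closed_fun_ge0 => v.
  by apply: continuousB; exact: vec_mx_coord_continuous.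
apply: closed_fun_ge0 => v; apply: continuous_sum => k _; apply: continuous_sum => j _.
by apply: continuousM; [exact: vec_mx_coord_continuous|exact: cst_continuous].
Qed.

Lemma closed_offdiag_in d : closed [set v | offdiag_in d (vec_mx v)]%classic.
Proof.
have -> : [set v | offdiag_in d (vec_mx v)]%classic =
    (\bigcap_(p in [set p : 'I_n * 'I_n | p.1 != p.2])
      ([set v | 0 <= (vec_mx v : 'M[R]_n) p.1 p.2 - d] `&`
       [set v | 0 <= 1 - d - (vec_mx v : 'M[R]_n) p.1 p.2]))%classic.
  apply/seteqP; split=> v /= vd => [[i j] /= /vd /andP[? ?]|i j ij].
    by split; rewrite /= subr_ge0.
  by have /= [] := vd (i, j) ij; rewrite !subr_ge0 => -> ->.
apply: closed_bigI => -[i j] _; apply: closedI; apply: closed_fun_ge0 => v.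
  by apply: continuousB; [exact: vec_mx_coord_continuous|exact: cst_continuous].
apply: (continuousB (f := cst (1 - d))); first exact: cst_continuous.
exact: vec_mx_coord_continuous.
Qed.

End MatrixTopology.

Section Barrier.
Context {R : realType} {n : nat} (a b : 'I_n -> 'I_n -> R) (C eps : R).
Hypotheses (C_gt0 : 0 < C) (eps_gt0 : 0 < eps).
Hypothesis eps_ab : forall i j, i != j -> eps <= a i j /\ eps <= b i j.
Implicit Types P D : 'M[R]_n.

(** With weight [1] on the logarithms that (CREG) rewards and [eps] on the others, this is the
    perturbed objective at [alpha = ln P], [beta = ln (1 - P)]. *)
Definition barrier P : R :=
  \sum_i \sum_(j | i != j) (a i j * ln (P i j) + b i j * ln (1 - P i j))
  - C * \tr P.

(** All terms of the barrier are nonpositive, so each one alone is at least [m]. Thus a superlevel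
    set is bounded and stays away from the faces of the box. *)
Lemma barrier_bounds m P : psd P ->
    (forall i j, i != j -> 0 < P i j < 1) -> m <= barrier P ->
  [/\ m <= 0, offdiag_in (expR (m / eps)) P & forall i, P i i <= - m / C].
Proof.
move=> pP intP mP; pose g i j := - (a i j * ln (P i j) + b i j * ln (1 - P i j)).
have lnP i j : i != j -> ln (P i j) <= 0 /\ ln (1 - P i j) <= 0.
  by move=> /intP /andP[P0 P1]; split; apply: ln_le0; lra.
have g0 i j : i != j -> 0 <= g i j.
  move=> ij; have [ea eb] := eps_ab ij; have [lP lP'] := lnP i j ij.
  have [a0 b0] : 0 <= a i j /\ 0 <= b i j.
    by split; apply: le_trans (ltW eps_gt0) _.
  by rewrite /g opprD addr_ge0 // oppr_ge0 mulr_ge0_le0.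
have gs0 i : 0 <= \sum_(j | i != j) g i j by apply: sumr_ge0 => j; exact: g0.
have P0 i : 0 <= P i i by exact: psd_diag_ge0.
have tr0 : 0 <= C * \tr P by rewrite mulr_ge0 ?sumr_ge0 // ltW.
have mE : \sum_i \sum_(j | i != j) g i j + C * \tr P <= - m.
  rewrite lerNr opprD; suff -> : - \sum_i \sum_(j | i != j) g i j
    = \sum_i \sum_(j | i != j) (a i j * ln (P i j) + b i j * ln (1 - P i j)) by [].
  rewrite -sumrN; apply: eq_bigr => i _; rewrite -sumrN.
  by apply: eq_bigr => j _; rewrite opprK.
have gg0 : 0 <= \sum_i \sum_(j | i != j) g i j by exact: sumr_ge0.
have m0 : m <= 0 by lra.
split=> // [i j ij|i].
  have gm : g i j <= - m.
    suff : g i j <= \sum_i \sum_(j | i != j) g i j by lra.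
    rewrite (bigD1 i) //= (bigD1 j) //= -addrA lerDl addr_ge0 ?sumr_ge0 //.
    by move=> k /andP[/g0].
  have [aij bij] := eps_ab ij; have [lP lP'] := lnP i j ij.
  have /andP[Pij0 Pij1] := intP i j ij; rewrite /g in gm.
  have h c l : eps <= c -> l <= 0 -> c * l <= eps * l by move=> ec l0; exact: ler_wnM2r.
  have el0 l : l <= 0 -> eps * l <= 0 by move=> l0; rewrite mulr_ge0_le0 // ltW.
  have hP := h _ _ aij lP; have hP' := h _ _ bij lP'.
  have eP := el0 _ lP; have eP' := el0 _ lP'.
  apply/andP; split.
    by rewrite -[leRHS]lnK ?posrE // ler_expR ler_pdivrMr //; lra.
  rewrite lerBrDr addrC -lerBrDr -[leRHS]lnK ?posrE ?subr_gt0 //.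
  by rewrite ler_expR ler_pdivrMr //; lra.
rewrite ler_pdivlMr // mulrC; suff : C * P i i <= C * \tr P by lra.
rewrite ler_pM2l // /mxtrace (bigD1 i) //= lerDl.
by apply: sumr_ge0.
Qed.

Lemma barrier_continuous d v : 0 < d -> offdiag_in d (vec_mx v) ->
  {for v, continuous (fun w => barrier (vec_mx w))}.
Proof.
move=> d0 vd; rewrite /barrier; apply: continuousB; last first.
  apply: continuousM; first exact: cst_continuous.
  apply: continuous_sum => i _.
  exact: vec_mx_coord_continuous.
apply: continuous_sum => i _; apply: continuous_sum => j ij.
have /andP[vd0 vd1] := vd i j ij.
apply: continuousD; apply: continuousM; try exact: cst_continuous.
  apply: continuous_comp; first exact: vec_mx_coord_continuous.
  by apply: continuous_ln; lra.
apply: continuous_comp; last by apply: continuous_ln; lra.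
by apply: continuousB; [exact: cst_continuous|exact: vec_mx_coord_continuous].
Qed.

(** The superlevel set of one interior point [P0] lies in a compact set [K] on which the barrier is
    continuous; points below that level are beaten by [P0]. *)
Lemma barrier_argmax : exists P d, [/\ psd P, 0 < d, offdiag_in d P &
  forall P', psd P' -> (forall i j, i != j -> 0 < P' i j < 1) ->
    barrier P' <= barrier P].
Proof.
pose P0 : 'M[R]_n := \matrix_(i, j) if i == j then n%:R else 2^-1.
have pP0 : psd P0.
  apply: diag_dominant_psd => [|i j ij|i]; last by rewrite mxE eqxx.
    by apply/matrixP => i j; rewrite !mxE eq_sym.
  by rewrite mxE (negbTE ij); lra.
have intP0 i j : i != j -> 0 < P0 i j < 1.
  by move=> ij; rewrite mxE (negbTE ij); lra.
set m := barrier P0; pose d := expR (m / eps).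
(* One interval serves all entries: as [m <= 0], it contains the off-diagonal range and the diagonal
   bound [- m / C]. *)
pose K := ([set v : 'rV[R]_(n * n) | forall k, `[0, 1 - m / C]%classic (v 0 k)] `&`
  ([set v | psd (vec_mx v : 'M[R]_n)] `&` [set v | offdiag_in d (vec_mx v)]))%classic.
have inK P : psd P -> (forall i j, i != j -> 0 < P i j < 1) -> m <= barrier P ->
    K (mxvec P).
  move=> pP intP mP; have [m0 Pd Pdiag] := barrier_bounds pP intP mP.
  split=> /=; last by rewrite mxvecK.
  have mC : m / C <= 0 by rewrite ler_pdivrMr ?mul0r.
  move=> k; case/mxvec_indexP: k => i j; rewrite mxvecE in_itv /=.
  have [<-|ij] := eqVneq i j; last by have := intP i j ij; lra.
  by have := Pdiag i; have := psd_diag_ge0 i pP; lra.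
have cK : compact K.
  apply: compact_closedI; last first.
    by apply: closedI; [exact: closed_psd|exact: closed_offdiag_in].
  by apply: (@rV_compact R _ (fun=> `[0, 1 - m / C]%classic)) => _; exact: segment_compact.
have K0 : K (mxvec P0) by exact: inK.
have [||v /set_mem Kv vmax] := @compact_EVT_max _ _ (fun v => barrier (vec_mx v)) K _ cK.
- by exists (mxvec P0).
- apply: continuous_in_subspaceT => v /set_mem[_ [_ vd]].
  by apply: barrier_continuous vd; exact: expR_gt0.
have [_ [pv vd]] := Kv; exists (vec_mx v), d; split=> //; first exact: expR_gt0.
move=> P pP intP; have [mP|Pm] := leP m (barrier P).
  by have := vmax _ (mem_set (inK P pP intP mP)); rewrite mxvecK.
apply: le_trans (ltW Pm) _.
by have := vmax _ (mem_set K0); rewrite mxvecK.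
Qed.

End Barrier.

(** * First-order conditions at the barrier maximizer *)

Lemma ln_perturb (R : realType) (p h : R) : 0 < p -> p / 2 <= p + h ->
  ln p + h / p - 2 * (h / p) ^+ 2 <= ln (p + h).
Proof.
move=> p0 ph; set z := h / p.
have -> : p + h = p * (1 + z) by rewrite /z; field; rewrite gt_eqF.
have z2 : 2^-1 <= 1 + z.
  by rewrite -(ler_pM2l p0) /z mulrDr mulrCA divff ?gt_eqF // !mulr1.
have z1 : 0 < 1 + z by lra.
rewrite lnM ?posrE // -addrA lerD2l.
have -> : ln (1 + z) = - ln (1 - z / (1 + z)).
  have -> : 1 - z / (1 + z) = (1 + z)^-1 by field; rewrite gt_eqF.
  by rewrite lnV ?posrE // opprK.
(* The first step, [z - 2 z^2 <= z / (1 + z)], holds because [z >= - 1 / 2]; the second is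
   [ln w <= w - 1] at [w = 1 - z / (1 + z)]. *)
apply: (@le_trans _ _ (z / (1 + z))).
  rewrite ler_pdivlMr //; have := sqr_ge0 z; nra.
rewrite lerNr; apply: le_ln1Dx.
by rewrite ltrN2 ltr_pdivrMr //; lra.
Qed.

Lemma slope_le0 (R : realType) (t0 L M : R) : 0 < t0 ->
  (forall t, 0 < t <= t0 -> t * L <= t ^+ 2 * M) -> L <= 0.
Proof.
move=> t00 h; rewrite leNgt; apply/negP => L0.
(* For such [t] one gets [t M <= L / 2], against [L <= t M]. *)
pose t := Num.min t0 (L / (2 * (`|M| + 1))).
have M1 : 0 < `|M| + 1 by rewrite ltr_wpDl.
have t_gt0 : 0 < t by rewrite /t lt_min t00 divr_gt0 // mulr_gt0.
have tL : t * (2 * (`|M| + 1)) <= L by rewrite -ler_pdivlMr ?mulr_gt0 // ge_min lexx orbT.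
have := h t; rewrite t_gt0 ge_min lexx /= => /(_ isT).
rewrite expr2 -mulrA ler_pM2l // => LtM.
have tM : t * M <= t * `|M| by rewrite ler_pM2l // ler_norm.
by nra.
Qed.

Section KKT.
Context {R : realType} {n : nat} (a b : 'I_n -> 'I_n -> R) (C : R).
Hypothesis ab_ge0 : forall i j, i != j -> 0 <= a i j /\ 0 <= b i j.
Implicit Types P D : 'M[R]_n.

(** The negative gradient of the barrier, which has the shape [u - r] of a dual matrix with diagonal
    [C]. *)
Definition kkt_mx P : 'M[R]_n :=
  \matrix_(i, j) if i == j then C else b i j / (1 - P i j) - a i j / P i j.

(** Weighted sum of [ln_perturb] with [h = t D] for [ln P] and [h = - t D] for [ln (1 - P)]: a lower
    bound with the exact linear term and a quadratic error. *)
Lemma barrier_perturb P D t :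
    (forall i j, i != j -> [/\ 0 < P i j, P i j < 1,
      P i j / 2 <= P i j + t * D i j
      & (1 - P i j) / 2 <= 1 - P i j - t * D i j]) ->
  barrier a b C P + t * (- \sum_i \sum_j kkt_mx P i j * D i j)
    - t ^+ 2 * (2 * \sum_i \sum_(j | i != j)
        (a i j * (D i j / P i j) ^+ 2 + b i j * (D i j / (1 - P i j)) ^+ 2))
  <= barrier a b C (P + t *: D).
Proof.
move=> Pt.
have -> : \sum_i \sum_j kkt_mx P i j * D i j
    = \sum_i \sum_(j | i != j) kkt_mx P i j * D i j + C * \tr D.
  rewrite [C * _]mulr_sumr -big_split; apply: eq_bigr => i _ /=.
  rewrite (bigD1 i) //= mxE eqxx addrC; congr (_ + _).
  by apply: eq_bigl => j; rewrite eq_sym.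
rewrite /barrier mxtraceD mxtraceZ -subr_ge0.
set S4 := \sum_i _; set S1 := \sum_i _; set S2 := \sum_i _; set S3 := \sum_i _.
suff : 0 <= S4 - S1 - t * (- S2) + t ^+ 2 * (2 * S3) by lra.
rewrite mulrN opprK /S1 /S2 /S3 /S4 !pair_big_dep /= -sumrN !mulr_sumr -!big_split /=.
apply: sumr_ge0 => -[i j] /= ij.
have [Pij0 Pij1 hP hP'] := Pt i j ij; have [aij bij] := ab_ge0 ij.
rewrite !mxE (negbTE ij).
have h1 := ler_wpM2l aij (ln_perturb Pij0 hP).
have Pij1' : 0 < 1 - P i j by rewrite subr_gt0.
have h2 := ler_wpM2l bij (ln_perturb Pij1' hP').
rewrite opprD addrA; move: h1 h2; set p := (P i j)^-1; set q := (1 - P i j)^-1; lra.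
Qed.

(** By maximality the linear gain along [D] is at most the quadratic error for small [t], so
    [slope_le0] applies. *)
Lemma kkt_direction P D d : 0 < d -> offdiag_in d P ->
    (forall t, 0 <= t <= 1 -> psd (P + t *: D)) ->
    (forall P', psd P' -> (forall i j, i != j -> 0 < P' i j < 1) ->
      barrier a b C P' <= barrier a b C P) ->
  0 <= \sum_i \sum_j kkt_mx P i j * D i j.
Proof.
move=> d0 Pd PDt Pmax.
pose B := 1 + \sum_i \sum_j `|D i j|.
have DB i j : `|D i j| <= B.
  rewrite /B (bigD1 i) //= (bigD1 j) //= addrCA -addrA lerDl.
  by rewrite !addr_ge0 ?sumr_ge0 // => k _; rewrite sumr_ge0.
have B0 : 0 < B.
  by rewrite ltr_wpDr // sumr_ge0 // => i _; rewrite sumr_ge0.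
(* For [t <= d / (2 B)] every entry moves by at most [d / 2], hence at most half its distance to [0]
   or [1], as [barrier_perturb] requires. *)
rewrite -oppr_le0; apply: (@slope_le0 _ (Num.min 1 (d / (2 * B)))).
  by rewrite lt_min ltr01 divr_gt0 // mulr_gt0.
move=> t /andP[t0]; rewrite le_min => /andP[t1 tB].
have tD i j : `|t * D i j| <= d / 2.
  rewrite normrM gtr0_norm //; apply: (@le_trans _ _ (t * B)).
    by rewrite ler_pM2l.
  by move: tB; rewrite invfM mulrA ler_pdivlMr.
have box i j : i != j -> [/\ 0 < P i j, P i j < 1,
      P i j / 2 <= P i j + t * D i j
      & (1 - P i j) / 2 <= 1 - P i j - t * D i j].
  move=> /Pd /andP[P0 P1]; have := tD i j; rewrite ler_norml => /andP[l u].
  by split; lra.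
have := barrier_perturb box.
have /(Pmax _) : psd (P + t *: D) by apply: PDt; rewrite t1 ltW.
have box' i j : i != j -> 0 < (P + t *: D) i j < 1.
  by move=> /box[? ? h1 h2]; rewrite !mxE; apply/andP; split; lra.
move=> /(_ box') le1 le2; have := le_trans le2 le1.
rewrite -addrA gerDl subr_le0; exact.
Qed.

Lemma kkt_psd P d : 0 < d -> offdiag_in d P -> psd P ->
    (forall i j, a i j = a j i) -> (forall i j, b i j = b j i) ->
    (forall P', psd P' -> (forall i j, i != j -> 0 < P' i j < 1) ->
      barrier a b C P' <= barrier a b C P) ->
  psd (kkt_mx P) /\ \tr (P *m kkt_mx P) <= 0.
Proof.
move=> d0 Pd pP aC bC Pmax.
have sQ : (kkt_mx P)^T = kkt_mx P.
  apply/matrixP => i j; rewrite !mxE eq_sym; case: eqP => // _.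
  by rewrite aC bC -[in LHS]pP.1 mxE.
split; first split=> // x.
  rewrite bilinE.
  have /(kkt_direction d0 Pd) := Pmax; move/(_ (x *m x^T)).
  have : forall t, 0 <= t <= 1 -> psd (P + t *: (x *m x^T)).
    by move=> t /andP[t0 _]; apply: psdD => //; apply: psdZ => //; exact: psd_rank1.
  move=> pt /(_ pt).
  by under eq_bigr do under eq_bigr do rewrite [(x *m _) _ _]mxE big_ord1 [_^T _ _]mxE.
rewrite mxtrace_mul_sym // -oppr_ge0.
have -> : - (\sum_i \sum_j P i j * kkt_mx P i j)
    = \sum_i \sum_j kkt_mx P i j * (- P) i j.
  rewrite -sumrN; apply: eq_bigr => i _; rewrite -sumrN; apply: eq_bigr => j _.
  by rewrite [(- P) _ _]mxE mulrN mulrC.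
(* Along [- P] the path is [(1 - t) P], positive semidefinite up to [t = 1]. *)
apply: (kkt_direction d0 Pd) => // t /andP[t0 t1].
rewrite scalerN -[X in psd (X - _)]scale1r -scalerBl.
by apply: psdZ; rewrite ?subr_ge0.
Qed.

End KKT.

(** * Strong duality *)

Section StrongDuality.
Context {R : realType} {n : nat} (e : rel 'I_n) (C : R).
Hypotheses (e_sym : symmetric e) (e_irr : irreflexive e).

Lemma sum_offdiag_le (f : 'I_n -> 'I_n -> R) c : 0 <= c ->
  (forall i j, i != j -> f i j <= c) ->
  \sum_i \sum_(j | i != j) f i j <= (n * n)%:R * c.
Proof.
move=> c0 fc.
have -> : (n * n)%:R * c = \sum_(i < n) \sum_(j < n) c.
  by rewrite !sumr_const card_ord -mulrnA mulr_natl.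
apply: ler_sum => i _; apply: (@le_trans _ _ (\sum_(j | i != j) c)).
  by apply: ler_sum => j; exact: fc.
by rewrite [leRHS](bigID (fun j => i != j)) /= lerDl sumr_ge0.
Qed.

Lemma barrier_pair eps : 0 < C -> 0 < eps <= 1 ->
  exists x y, [/\ creg_feasible x, dreg_feasible e C y
    & dreg_obj e y - creg_obj e C x <= (n * n)%:R * eps].
Proof.
move=> C0 /andP[eps0 eps1].
pose a i j : R := if e i j then 1 else eps.
pose b i j : R := if e i j then eps else 1.
have eps_ab i j : i != j -> eps <= a i j /\ eps <= b i j.
  by rewrite /a /b; case: (e i j).
have a0 i j : 0 < a i j by rewrite /a; case: ifP.
have b0 i j : 0 < b i j by rewrite /b; case: ifP.
have ab0 i j : i != j -> 0 <= a i j /\ 0 <= b i j by rewrite !ltW.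
have [P [d [pP d0 Pd Pmax]]] := barrier_argmax C0 eps0 eps_ab.
have aC i j : a i j = a j i by rewrite /a e_sym.
have bC i j : b i j = b j i by rewrite /b e_sym.
have [pQ trQ] := kkt_psd ab0 d0 Pd pP aC bC Pmax.
have int i j : i != j -> 0 < P i j /\ 0 < 1 - P i j.
  by move=> /Pd /andP[? ?]; split; lra.
pose x := CregPoint P (fun i j => ln (P i j)) (fun i j => ln (1 - P i j)).
pose r i j := a i j / P i j; pose u i j := b i j / (1 - P i j).
pose y := DregPoint (kkt_mx a b C P) r (fun i j => -1 - ln (r i j))
  u (fun i j => -1 - ln (u i j)).
have r0 i j : i != j -> 0 < r i j by move=> /int[? _]; rewrite divr_gt0.
have u0 i j : i != j -> 0 < u i j by move=> /int[_ ?]; rewrite divr_gt0.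
have adj_neq i j : e i j -> i != j by case: eqVneq => // <-; rewrite e_irr.
have fx : creg_feasible x.
  by split=> // i j /int[? ?] /=; rewrite !Kexp_at1 !lnK ?posrE.
have fy : dreg_feasible e C y.
  split=> //= [i j /adj_neq ij|i j /andP[ij _]|i j ij|i].
  - by apply/lne_constraint; [rewrite ltW ?r0|split; rewrite ?r0].
  - by apply/lne_constraint; [rewrite ltW ?u0|split; rewrite ?u0].
  - by rewrite mxE (negbTE ij) !ltW ?r0 ?u0.
  - by rewrite mxE eqxx.
exists x, y; split=> //; rewrite (duality_gap e_irr _ fy).
(* Each pair has slack exactly [eps]: the logarithmic product vanishes and the other equals
   [eps]. *)
have : \sum_i \sum_(j | i != j) slack e x y i j <= (n * n)%:R * eps.
  apply: sum_offdiag_le => [|i j ij]; first exact: ltW.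
  have [P0 P1] := int i j ij.
  rewrite /slack /= /s_full /t_full /v_full /w_full /= /r /u /a /b.
  case: (e i j); rewrite div1r lnV ?posrE // ?opprK.
    have -> : eps / (1 - P i j) * (1 - P i j) = eps by rewrite divfK ?gt_eqF.
    by rewrite mulVf ?gt_eqF //; lra.
  have -> : eps / P i j * P i j = eps by rewrite divfK ?gt_eqF.
  by rewrite mulVf ?gt_eqF //; lra.
by rewrite /= in trQ *; lra.
Qed.

Lemma free_trace_pair eps : ((0 < n)%N -> C = 0) -> 0 < eps <= 1 ->
  exists x y, [/\ creg_feasible x, dreg_feasible e C y
    & dreg_obj e y - creg_obj e C x <= (n * n)%:R * eps].
Proof.
move=> C0 /andP[eps0 eps1].
pose h := eps / 2; have h0 : 0 < h by rewrite /h; lra.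
have h1 : 0 < 1 - h by rewrite /h; lra.
have heps : h + h = eps by rewrite /h; lra.
(* Off the diagonal [P] is within [h] of the ideal values [1] on edges and [0] on non-edges. *)
pose P : 'M[R]_n := \matrix_(i, j)
  if i == j then n%:R else if e i j then 1 - h else h.
have Poff i j : i != j -> P i j = if e i j then 1 - h else h.
  by move=> ij; rewrite mxE (negbTE ij).
have int i j : i != j -> 0 < P i j /\ 0 < 1 - P i j.
  by move=> ij; rewrite Poff //; case: ifP => _; split; lra.
pose x := CregPoint P (fun i j => ln (P i j)) (fun i j => ln (1 - P i j)).
pose y := DregPoint (0 : 'M[R]_n) (fun _ _ => 1) (fun _ _ => -1)
  (fun _ _ => 1) (fun _ _ => -1).
have fx : creg_feasible x.
  split=> [|i j /int[? ?] /=]; last by rewrite !Kexp_at1 !lnK ?posrE.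
  apply: diag_dominant_psd => [|i j /int[? ?]|i]; last by rewrite mxE eqxx.
    by apply/matrixP => i j; rewrite !mxE eq_sym e_sym.
  by apply/andP; split; lra.
have fy : dreg_feasible e C y.
  split=> //= [i j _|i j _|i j _|i|].
  - by apply/lne_constraint; rewrite // ln1; split=> //; lra.
  - by apply/lne_constraint; rewrite // ln1; split=> //; lra.
  - by rewrite mxE subrr.
  - by rewrite mxE C0 // (leq_trans _ (ltn_ord i)).
  - by split=> [|v]; rewrite ?trmx0 // mulmx0 mul0mx mxE.
exists x, y; split=> //; rewrite (duality_gap e_irr _ fy) /= mulmx0 mxtrace0 add0r.
apply: sum_offdiag_le => [|i j ij]; first exact: ltW.
(* The slack of every pair is [- ln (1 - h) <= h / (1 - h) <= 2 h], since [h <= 1 / 2]. *)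
have ln_h : - ln (1 - h) <= eps.
  rewrite -lnV ?posrE //.
  have -> : (1 - h)^-1 = 1 + h / (1 - h) by field; rewrite gt_eqF.
  apply: le_trans (le_ln1Dx _) _.
    by apply: lt_trans (divr_gt0 h0 h1); lra.
  by rewrite ler_pdivrMr // -heps; nra.
rewrite /slack /= /s_full /t_full /v_full /w_full /= Poff //.
by case: (e i j); rewrite ?subKr; lra.
Qed.

Lemma creg_value_negative : (0 < n)%N -> C < 0 -> creg_value e C = +oo%E.
Proof.
move=> n0 C0; apply: eq_infty => A.
pose h : R := ln 2^-1.
pose K := \sum_(i < n) \sum_(j | e i j) h + \sum_(i < n) \sum_(j | nonadj e i j) h.
(* The summand [n] gives diagonal dominance; the other makes the reward [- C t] outweigh the target
   [A] and the logarithmic part [K]. *)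
pose t := n%:R + (`|A| + `|K|) / - C.
pose P : 'M[R]_n := \matrix_(i, j) if i == j then t else 2^-1.
have CN0 : 0 < - C by rewrite oppr_gt0.
have AK0 : 0 <= (`|A| + `|K|) / - C by rewrite divr_ge0 ?addr_ge0 // ltW.
pose x := CregPoint P (fun _ _ => h) (fun _ _ => h).
have fx : creg_feasible x.
  split=> [|i j ij /=].
    apply: diag_dominant_psd => [|i j ij|i]; last by rewrite mxE eqxx lerDl.
      by apply/matrixP => i j; rewrite !mxE eq_sym.
    by rewrite mxE (negbTE ij); apply/andP; split; lra.
  rewrite mxE (negbTE ij) !Kexp_at1 lnK ?posrE //.
  by split; lra.
apply: (@le_trans _ _ (creg_obj e C x)%:E); last first.
  by apply: ereal_sup_ubound; exists x.
have tr_x : \tr (cP x) = n%:R * t.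
  rewrite /mxtrace; under eq_bigr do rewrite mxE eqxx.
  by rewrite sumr_const card_ord mulr_natl.
rewrite lee_fin /creg_obj /= -/K tr_x.
have t_ge : `|A| + `|K| <= - C * t.
  by rewrite mulrDr mulrCA divff ?gt_eqF // mulr1 lerDr mulr_ge0 // ltW.
have t0 : 0 <= - C * t by apply: le_trans t_ge; rewrite addr_ge0.
have nt : - C * t <= - C * t * n%:R.
  by rewrite ler_peMr // ler1n.
have := ler_norm A; have := ler_norm (- K); rewrite normrN; lra.
Qed.

Lemma creg_value_le_dreg_value : (creg_value e C <= dreg_value e C)%E.
Proof.
apply: ge_ereal_sup => _ [x fx <-]; apply: le_ereal_inf_tmp => _ [y fy <-].
by rewrite lee_fin; exact: weak_duality.
Qed.

Lemma dreg_value_le_creg_value :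
    (forall eps : R, 0 < eps <= 1 -> exists x y,
      [/\ creg_feasible x, dreg_feasible e C y
        & dreg_obj e y - creg_obj e C x <= (n * n)%:R * eps]) ->
  (dreg_value e C <= creg_value e C)%E.
Proof.
move=> pairs; apply/lee_addgt0Pr => d d0.
have N0 : 0 < (n * n).+1%:R :> R by rewrite ltr0n.
(* The successor keeps the denominator positive when [n = 0]. *)
pose eps := Num.min 1 (d / (n * n).+1%:R).
have eps0 : 0 < eps by rewrite lt_min ltr01 divr_gt0.
have [|x [y [fx fy xy]]] := pairs eps; first by rewrite eps0 ge_min lexx.
have Neps : (n * n)%:R * eps <= d.
  apply: (@le_trans _ _ ((n * n).+1%:R * eps)).
    by rewrite ler_pM2r // ler_nat.
  by rewrite mulrC -ler_pdivlMr // ge_min lexx orbT.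
apply: (@le_trans _ _ (dreg_obj e y)%:E).
  by apply: ereal_inf_lbound; exists y.
apply: (@le_trans _ _ ((creg_obj e C x)%:E + d%:E)%E).
  by rewrite -EFinD lee_fin; lra.
by rewrite leeD2r //; apply: ereal_sup_ubound; exists x.
Qed.

Lemma strong_duality : creg_value e C = dreg_value e C.
Proof.
apply/eqP; rewrite eq_le creg_value_le_dreg_value /=.
(* For [n = 0] the trace vanishes whatever the sign of [C], so the free-trace pair serves. *)
have [n0|n0] := posnP n.
  apply: dreg_value_le_creg_value => eps; apply: free_trace_pair.
  by rewrite n0.
have [C0|C0|C0] := ltgtP C 0.
- by rewrite creg_value_negative // leey.
- by apply: dreg_value_le_creg_value => eps; exact: barrier_pair.
- by apply: dreg_value_le_creg_value => eps; apply: free_trace_pair.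
Qed.

End StrongDuality.

Lemma creg_value_optimal (R : realType) (n : nat) (e : rel 'I_n) (C : R) x :
  creg_optimal e C x -> creg_value e C = (creg_obj e C x)%:E.
Proof.
move=> [fx xmax]; apply/eqP; rewrite eq_le; apply/andP; split.
  by apply: ge_ereal_sup => _ [z fz <-]; rewrite lee_fin xmax.
by apply: ereal_sup_ubound; exists x.
Qed.

Lemma dreg_value_optimal (R : realType) (n : nat) (e : rel 'I_n) (C : R) y :
  dreg_optimal e C y -> dreg_value e C = (dreg_obj e y)%:E.
Proof.
move=> [fy ymin]; apply/eqP; rewrite eq_le; apply/andP; split.
  by apply: ereal_inf_lbound; exists y.
by apply: le_ereal_inf_tmp => _ [z fz <-]; rewrite lee_fin ymin.
Qed.

Theorem proposition2p2 (R : realType) (n : nat) (e : rel 'I_n)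
    (e_sym : symmetric e) (e_irr : irreflexive e) (C : R) :
  creg_value e C = dreg_value e C /\
  forall (x : creg_point R n) (y : dreg_point R n),
    creg_optimal e C x -> dreg_optimal e C y ->
    cP x *m dQ y = 0 /\
    forall i j : 'I_n, i != j ->
      [/\ dot3 (lambda_vec e y i j) (cP x i j, 1, calpha x i j) = 0,
          dr y i j * cP x i j + s_full e y i j
            + t_full R e i j * calpha x i j = 0,
          dot3 (nu_vec e y i j) (1 - cP x i j, 1, cbeta x i j) = 0
        & du y i j * (1 - cP x i j) + v_full e y i j
            + w_full R e i j * cbeta x i j = 0].
Proof.
have val_eq := strong_duality C e_sym e_irr.
split=> // x y x_opt y_opt.
(* Both values are attained, so strong duality makes the gap of this pair zero. *)
have xy : creg_obj e C x = dreg_obj e y.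
  by apply: EFin_inj; rewrite -(creg_value_optimal x_opt) -(dreg_value_optimal y_opt).
have [PQ0 slack0] := complementary_slackness e_irr x_opt.1 y_opt.1 xy.
split=> // i j /slack0[lam0 nu0]; split=> //.
  by move: lam0; rewrite /= mulr1.
by move: nu0; rewrite /= mulr1.
Qed.
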